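(* Let $\mathbf{S}=\{S_1,S_2,\dots\}$ be a finite-state stationary ergodic Markov process with set of states $A_n=\{1,\dots,n\}$, $n\ge1$. Then the permutation excess entropy $\mathbf{E}^*(\mathbf{S})$ exists and $\mathbf{E}^*(\mathbf{S})=\mathbf{E}(\mathbf{S})$, where $\mathbf{E}(\mathbf{S})$ is the excess entropy.
   Context: A finite-state stationary ergodic Markov process with state set $A_n$ has a transition matrix $P=(p_{ij})_{1\le i,j\le n}$ with $p_{ij}\ge0$ and $\sum_{j}p_{ij}=1$ for all $i$; ergodicity is equivalent to irreducibility of $P$ (for all $i,j$ there is $l>0$ with $(P^l)_{ij}>0$). Let $\mathbf{p}=(p_1,\dots,p_n)$ be its unique stationary distribution ($p_i>0$, $\sum_i p_i=1$, $\sum_i p_ip_{ij}=p_j$). For a word $s_1^L=s_1\cdots s_L\in A_n^L$, $p(s_1^L)=\Pr\{S_1=s_1,\dots,S_L=s_L\}=p_{s_1}p_{s_1s_2}\cdots p_{s_{L-1}s_L}$. Logarithms are to base 2. $\mathcal{S}_L$ is the set of permutations of $\{1,\dots,L\}$. A word $s_1^L\in A_n^L$ is of type $\pi\in\mathcal{S}_L$ if for every $i=1,\dots,L-1$ we have $s_{\pi(i)}\le s_{\pi(i+1)}$, and $\pi(i)<\pi(i+1)$ whenever $s_{\pi(i)}=s_{\pi(i+1)}$. Each word has a unique type; $\phi:A_n^L\to\mathcal{S}_L$ sends a word to its type. For $\pi\in\mathcal{S}_L$ put $p(\pi)=\sum_{s_1^L\in\phi^{-1}(\pi)}p(s_1^L)$.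 $H(S_1^L)=-\sum_{s_1^L\in A_n^L}p(s_1^L)\log p(s_1^L)$ and $H^*(S_1^L)=-\sum_{\pi\in\mathcal{S}_L}p(\pi)\log p(\pi)$ (with $0\log0=0$). The entropy rate is $h(\mathbf{S})=\lim_{L\to\infty}\frac1LH(S_1^L)$ and the permutation entropy rate is $h^*(\mathbf{S})=\lim_{L\to\infty}\frac1LH^*(S_1^L)$; both limits exist for every finite-state stationary process. The excess entropy is $\mathbf{E}(\mathbf{S})=\lim_{L\to\infty}\left(H(S_1^L)-h(\mathbf{S})L\right)$ and the permutation excess entropy is $\mathbf{E}^*(\mathbf{S})=\lim_{L\to\infty}\left(H^*(S_1^L)-h^*(\mathbf{S})L\right)$, each when the limit exists. For a finite-state stationary Markov process, $\mathbf{E}(\mathbf{S})$ exists and equals $-\sum_i p_i\log p_i+\sum_{i,j}p_ip_{ij}\log p_{ij}$. *)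

(* Defs.v *)
From HB Require Import structures.
From mathcomp Require Import all_boot all_order all_algebra all_fingroup.
From mathcomp Require Import all_classical all_reals all_analysis.
Set Implicit Arguments.
Unset Strict Implicit.
Unset Printing Implicit Defensive.
Import Order.TTheory GRing.Theory Num.Theory.
Import numFieldNormedType.Exports.
Local Open Scope classical_set_scope.
Local Open Scope ring_scope.

(* Time and states are numbered from 0: [S k] is the variable S_{k+1}, and the
   ordinal [i : 'I_n] is the state i+1 of A_n = {1, ..., n}. *)

(* 'I_n carries the discrete sigma-algebra. *)
Definition is_process (d : measure_display) (T : measurableType d) (n : nat)
    (S : nat -> T -> 'I_n) : Prop :=
  forall (k : nat) (a : 'I_n), measurable (S k @^-1` [set a]).

Definition word_event (T : Type) (n : nat) (S : nat -> T -> 'I_n)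
    (k L : nat) (w : L.-tuple 'I_n) : set T :=
  [set t | forall i : 'I_L, S (k + i)%N t = tnth w i].

Definition word_prob (R : realType) (d : measure_display)
    (T : measurableType d) (Pr : probability T R) (n : nat)
    (S : nat -> T -> 'I_n) (L : nat) (w : L.-tuple 'I_n) : R :=
  fine (Pr (word_event S 0 w)).

Definition is_stationary (R : realType) (d : measure_display)
    (T : measurableType d) (Pr : probability T R) (n : nat)
    (S : nat -> T -> 'I_n) : Prop :=
  forall (k L : nat) (w : L.-tuple 'I_n),
    Pr (word_event S k w) = Pr (word_event S 0 w).

Definition is_stochastic (R : realType) (n : nat) (P : 'M[R]_n) : Prop :=
  (forall i j, 0 <= P i j) /\ (forall i, \sum_j P i j = 1).

(* The Markov property, multiplied out so that conditioning on a null word is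
   harmless:
   Pr{S_1^L = w, S_{L+1} = j} = Pr{S_1^L = w} p_{w_L j} for every L >= 1. *)
Definition is_markov (R : realType) (d : measure_display)
    (T : measurableType d) (Pr : probability T R) (n : nat)
    (S : nat -> T -> 'I_n) (P : 'M[R]_n) : Prop :=
  is_stochastic P /\
  forall (L : nat) (w : L.+1.-tuple 'I_n) (j : 'I_n),
    word_prob Pr S [tuple of rcons w j] =
    word_prob Pr S w * P (tnth w ord_max) j.

(* The set of states of a stationary process is all of A_n: every p_i > 0. *)
Definition has_all_states (R : realType) (d : measure_display)
    (T : measurableType d) (Pr : probability T R) (n : nat)
    (S : nat -> T -> 'I_n) : Prop :=
  forall i : 'I_n, (0 < Pr (S 0%N @^-1` [set i]))%E.

Definition cylinders (n : nat) : set (set (nat -> 'I_n)) :=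
  [set C | exists (k : nat) (a : 'I_n), C = [set x | x k = a]].

Definition shift (n : nat) (x : nat -> 'I_n) : nat -> 'I_n :=
  fun k => x k.+1.

(* Ergodicity of the law of the process under the shift on A_n^N.  For a
   stationary Markov process with all p_i > 0 it amounts to irreducibility of
   the transition matrix. *)
Definition is_ergodic (R : realType) (d : measure_display)
    (T : measurableType d) (Pr : probability T R) (n : nat)
    (S : nat -> T -> 'I_n) : Prop :=
  forall B : set (nat -> 'I_n),
    <<s @cylinders n >> B -> @shift n @^-1` B = B ->
    Pr [set t | B (fun k => S k t)] = 0%E \/
    Pr [set t | B (fun k => S k t)] = 1%E.

Definition of_type (n L : nat) (w : L.-tuple 'I_n) (s : 'S_L) : bool :=
  [forall i : 'I_L, forall j : 'I_L, (j == i.+1 :> nat) ==>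
    ((tnth w (s i) <= tnth w (s j))%N &&
     ((tnth w (s i) == tnth w (s j)) ==> (s i < s j)%N))].

Definition perm_prob (R : realType) (d : measure_display)
    (T : measurableType d) (Pr : probability T R) (n : nat)
    (S : nat -> T -> 'I_n) (L : nat) (s : 'S_L) : R :=
  \sum_(w : L.-tuple 'I_n | of_type w s) word_prob Pr S w.

Definition log2 (R : realType) (x : R) : R := ln x / ln 2.

Definition block_entropy (R : realType) (d : measure_display)
    (T : measurableType d) (Pr : probability T R) (n : nat)
    (S : nat -> T -> 'I_n) (L : nat) : R :=
  - \sum_(w : L.-tuple 'I_n) word_prob Pr S w * log2 (word_prob Pr S w).

Definition perm_block_entropy (R : realType) (d : measure_display)
    (T : measurableType d) (Pr : probability T R) (n : nat)
    (S : nat -> T -> 'I_n) (L : nat) : R :=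
  - \sum_(s : 'S_L) perm_prob Pr S s * log2 (perm_prob Pr S s).

Definition entropy_rate (R : realType) (d : measure_display)
    (T : measurableType d) (Pr : probability T R) (n : nat)
    (S : nat -> T -> 'I_n) : R :=
  limn (fun L : nat => block_entropy Pr S L / L%:R).

Definition perm_entropy_rate (R : realType) (d : measure_display)
    (T : measurableType d) (Pr : probability T R) (n : nat)
    (S : nat -> T -> 'I_n) : R :=
  limn (fun L : nat => perm_block_entropy Pr S L / L%:R).

Definition excess_entropy (R : realType) (d : measure_display)
    (T : measurableType d) (Pr : probability T R) (n : nat)
    (S : nat -> T -> 'I_n) : R :=
  limn (fun L : nat => block_entropy Pr S L - entropy_rate Pr S * L%:R).

Definition perm_excess_entropy (R : realType) (d : measure_display)
    (T : measurableType d) (Pr : probability T R) (n : nat)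
    (S : nat -> T -> 'I_n) : R :=
  limn (fun L : nat =>
    perm_block_entropy Pr S L - perm_entropy_rate Pr S * L%:R).

(* [limn] of a divergent sequence is a junk value, so existence of an excess
   entropy also asserts that the rate in its definition is a genuine limit. *)
Definition excess_entropy_exists (R : realType) (d : measure_display)
    (T : measurableType d) (Pr : probability T R) (n : nat)
    (S : nat -> T -> 'I_n) : Prop :=
  cvgn (fun L : nat => block_entropy Pr S L / L%:R) /\
  cvgn (fun L : nat => block_entropy Pr S L - entropy_rate Pr S * L%:R).

Definition perm_excess_entropy_exists (R : realType) (d : measure_display)
    (T : measurableType d) (Pr : probability T R) (n : nat)
    (S : nat -> T -> 'I_n) : Prop :=
  cvgn (fun L : nat => perm_block_entropy Pr S L / L%:R) /\
  cvgn (fun L : nat =>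
    perm_block_entropy Pr S L - perm_entropy_rate Pr S * L%:R).

(* Main.v *)
(** The type of a word is a function of the word, so [H - H^*] is nonnegative
    and only words sharing their type with another word contribute to it.  A
    word in which every state occurs both in the first and in the second half
    is alone of its type.  Ergodicity makes the probability of missing some
    state during [L/2] steps decay exponentially in [L], whereas entropies of
    words of length [L] grow linearly; hence [H - H^* -> 0].  For a stationary
    Markov process [H] is affine in [L >= 1], so [H] and [H^*] have the same
    rate and the same excess.

    The contribution of a set of words is bounded by
    [- q ln q <= q ln N + 1/N] with [N = (2(n+1))^L]: the first terms add up to
    [L ln(2(n+1))] times the mass of the set, the second ones to at most
    [n^L / N <= 2^-L]. *)
Require Import Defs.
From mathcomp Require Import all_boot all_order all_algebra all_fingroup.
From mathcomp Require Import all_classical all_reals all_analysis.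
From mathcomp Require Import ring lra zify.

Set Implicit Arguments.
Unset Strict Implicit.
Unset Printing Implicit Defensive.
Import Order.TTheory GRing.Theory Num.Theory.
Import numFieldNormedType.Exports.
Local Open Scope ring_scope.

(** * The type of a word as a sorting permutation *)

Section Types.
Context {n L : nat}.
Implicit Types (w : L.-tuple 'I_n) (s : 'S_L) (x y : 'I_L).

(** The strict total order on positions that a type sorts: by value, ties broken by time. *)
Definition word_lt w x y : bool :=
  (tnth w x < tnth w y)%N || ((tnth w x == tnth w y) && (x < y)%N).

Lemma word_lt_irr w : irreflexive (word_lt w).
Proof. by move=> x; rewrite /word_lt !ltnn andbF. Qed.

Lemma word_lt_trans w : transitive (word_lt w).
Proof.
move=> y x z /orP[xy|/andP[/eqP xy xy']] /orP[yz|/andP[/eqP yz yz']];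
  rewrite /word_lt.
- by rewrite (ltn_trans xy yz).
- by rewrite -yz xy.
- by rewrite xy yz.
- by rewrite xy yz eqxx (ltn_trans xy' yz') orbT.
Qed.

Lemma word_lt_total w x y : x != y -> word_lt w x y || word_lt w y x.
Proof.
move=> xy; rewrite /word_lt -!val_eqE /=.
case: (ltngtP (tnth w x) (tnth w y)) => //= _.
by case: ltngtP xy => // /val_inj ->; rewrite eqxx.
Qed.

(** Transitivity of [word_lt] extends the comparison of consecutive positions to all pairs. *)
Lemma of_typeP w s :
  reflect (forall x y, (x < y)%N -> word_lt w (s x) (s y)) (of_type w s).
Proof.
apply: (iffP forallP) => [H|H x]; last first.
  apply/forallP => y; apply/implyP => /eqP yx.
  have := H x y; rewrite yx ltnSn => /(_ isT) /orP[xy|/andP[/eqP -> ->]].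
    by rewrite ltnW //=; apply/implyP => /eqP E; rewrite E ltnn in xy.
  by rewrite leqnn implybT.
have step x y : (y = x.+1 :> nat) -> word_lt w (s x) (s y).
  move=> yx; have /forallP/(_ y) := H x; rewrite yx eqxx /=.
  rewrite leq_eqVlt /word_lt val_eqE => /andP[/orP[/eqP->|->//]].
  by rewrite eqxx /= => ->; rewrite orbT.
move=> x [y yL]; elim: y yL => //= y IH yL; rewrite ltnS leq_eqVlt.
case/orP => [/eqP xy|xy]; first by apply: step; rewrite xy.
have yL' : (y < L)%N by exact: ltnW.
by apply: word_lt_trans (IH yL' xy) _; exact: step.
Qed.

Definition word_rank w x := #|[set y | word_lt w y x]|.

Lemma word_rank_mono w x y : word_lt w x y -> (word_rank w x < word_rank w y)%N.
Proof.
move=> xy; apply/proper_card/properP; split.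
  by apply/fintype.subsetP => z; rewrite !inE => /word_lt_trans; exact.
by exists x; rewrite !inE ?word_lt_irr.
Qed.

Lemma word_rank_bound w x : (word_rank w x < L)%N.
Proof.
rewrite -[X in (_ < X)%N]card_ord -cardsT; apply/proper_card/properP.
by split; [exact: finset.subsetT|exists x; rewrite !inE ?word_lt_irr].
Qed.

Definition word_rank_ord w x := Ordinal (word_rank_bound w x).

Lemma word_rank_inj w : injective (word_rank_ord w).
Proof.
move=> x y /(congr1 val)/= E; apply/eqP/negPn/negP => /(word_lt_total w)/orP[].
  by move/word_rank_mono; rewrite E ltnn.
by move/word_rank_mono; rewrite E ltnn.
Qed.

(** The rank sends a position to its place in the sorted order, whereas a type sends a place to a
    position; hence the inverse. *)
Definition word_type w : 'S_L := ((perm (@word_rank_inj w))^-1)%g.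

(** Existence and uniqueness of the type. If [s] sorts [w], the predecessors of [s x] are the [s z]
    with [z < x], so [s x] has rank [x] and [s] inverts the rank. *)
Lemma of_type_word_type w s : of_type w s = (s == word_type w).
Proof.
apply/of_typeP/eqP => [H|-> x y].
  apply: (can_inj invgK); rewrite /word_type invgK; apply/permP => x.
  rewrite [RHS]permE; apply/val_inj/esym; rewrite [LHS]/=.
  suff {x} E x : word_rank w (s x) = x by rewrite -{1}[x](permKV s) E.
  rewrite /word_rank.
  rewrite -(card_imset _ (@perm_inj _ s^-1)%g).
  suff -> : [set (s^-1)%g z | z in [set y | word_lt w y (s x)]]
      = [set z : 'I_L | (z < x)%N].
    rewrite -sum1dep_card -(big_ord_widen L (fun=> 1%N)) ?sum1_card ?card_ord//.
    exact: ltnW.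
  apply/finset.setP => z; rewrite inE; apply/imsetP/idP => [[y]|zx]; last first.
    by exists (s z); rewrite ?inE ?permK // H.
  rewrite inE => yx ->; rewrite ltnNge; apply/negP.
  rewrite leq_eqVlt => /orP[/eqP/val_inj E|/H]; last first.
    by rewrite permKV => /word_lt_trans/(_ yx); rewrite word_lt_irr.
  by move: yx; rewrite E permKV word_lt_irr.
set r := perm (@word_rank_inj w).
have rE z : word_rank w ((r^-1)%g z) = z.
  by have /(congr1 val)/= := permKV r z; rewrite permE.
move=> xy; rewrite /word_type -/r.
have /(word_lt_total w)/orP[//|/word_rank_mono] : (r^-1)%g x != (r^-1)%g y.
  by apply: contraTneq xy => /perm_inj ->; rewrite ltnn.
by rewrite !rE ltnNge (ltnW xy).
Qed.

(** The common type [s] determines the order: [word_lt w x y] forces [x] to come before [y] in the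
    list of values of [s]. *)
Lemma word_lt_same_type w w' : word_type w = word_type w' ->
  forall x y, word_lt w x y -> word_lt w' x y.
Proof.
move=> E x y xy; pose s := word_type w.
have /of_typeP H : of_type w s by rewrite of_type_word_type.
have /of_typeP H' : of_type w' s by rewrite of_type_word_type /s E.
rewrite -[x](permKV s) -[y](permKV s); apply: H'.
rewrite ltnNge leq_eqVlt; apply/negP => /orP[/eqP/val_inj E'|/H].
  by move: xy; rewrite -[x](permKV s) -E' permKV word_lt_irr.
by rewrite !permKV => /word_lt_trans/(_ xy); rewrite word_lt_irr.
Qed.

Definition visits_both_parts (h : nat) w : bool := [forall a,
  [exists x : 'I_L, (x < h)%N && (tnth w x == a)] &&
  [exists x : 'I_L, (h <= x)%N && (tnth w x == a)]].

(* An occurrence of [a.+1] before time [h] and one of [a] after time [h] must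
   carry strictly increasing values, in the reverse order of time, in every word
   of the same type.  Climbing from 0, respectively descending from [n.-1], this
   bounds the values of such a word from below, respectively from above. *)
Lemma word_type_inj_visits h w w' : visits_both_parts h w ->
  word_type w = word_type w' -> w = w'.
Proof.
move=> V E.
have {}V a : (exists2 x : 'I_L, (x < h)%N & tnth w x = a) /\
    (exists2 x : 'I_L, (h <= x)%N & tnth w x = a).
  have /andP[/existsP[x /andP[xh /eqP xa]] /existsP[y /andP[hy /eqP ya]]] :=
    forallP V a.
  by split; [exists x|exists y].
have lt_w' := word_lt_same_type E.
have le_of x y : tnth w x = tnth w y -> (x <= y)%N ->
    (tnth w' x <= tnth w' y)%N.
  move=> xy; rewrite leq_eqVlt => /orP[/eqP/val_inj->//|xy'].
  have /lt_w' : word_lt w x y by rewrite /word_lt xy eqxx xy' orbT.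
  by move=> /orP[/ltnW//|/andP[/eqP->]].
have lt_of x y : (tnth w x < tnth w y)%N -> (y <= x)%N ->
    (tnth w' x < tnth w' y)%N.
  move=> xy yx; have /lt_w' : word_lt w x y by rewrite /word_lt xy.
  by move=> /orP[//|/andP[_]]; rewrite ltnNge yx.
have lower m k : tnth w k = m :> nat -> (m <= tnth w' k)%N.
  elim: m k => // m IH k km.
  have mn : (m < n)%N by rewrite ltnW // -km.
  (* A position [k] of the second part is traded for an earlier occurrence of its value; by [le_of]
     a lower bound for [w'] at [y] passes to [k]. *)
  have [y [yh yk ym]] :
      exists y, [/\ (y < h)%N, (y <= k)%N & tnth w y = tnth w k].
    have [kh|hk] := ltnP k h; first by exists k.
    have [[y yh ym] _] := V (tnth w k).
    by exists y; split => //; apply: ltnW; exact: leq_trans yh hk.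
  have [_ [x hx xm]] := V (Ordinal mn).
  apply: leq_trans (le_of _ _ ym yk); apply: leq_ltn_trans (IH x _) _.
    by rewrite xm.
  by apply: lt_of; [rewrite xm ym km|exact: ltnW (leq_trans yh hx)].
(* Here [m] is the distance of the value from the largest state, so the induction descends from the
   top. *)
have upper m k : (tnth w k + m = n.-1)%N -> (tnth w' k <= tnth w k)%N.
  elim: m k => [|m IH] k km.
    by rewrite -ltnS -[nat_of_ord (tnth w k)]addn0 km
      (leq_trans (ltn_ord _)) // leqSpred.
  have mn : ((tnth w k).+1 < n)%N by rewrite -ltn_predRL -km -addSnnS leq_addr.
  have [x [hx kx xk]] :
      exists x, [/\ (h <= x)%N, (k <= x)%N & tnth w k = tnth w x].
    have [kh|hk] := ltnP k h; last by exists k.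
    have [_ [x hx xm]] := V (tnth w k).
    by exists x; split => //; apply: ltnW; exact: leq_trans kh hx.
  have [[y yh ym] _] := V (Ordinal mn).
  apply: leq_trans (le_of _ _ xk kx) _; rewrite -ltnS.
  have -> : (tnth w k).+1 = tnth w y by rewrite ym.
  apply: leq_trans (IH y _); last by rewrite ym /= addSnnS.
  by apply: lt_of; [rewrite -xk ym /=|exact: ltnW (leq_trans yh hx)].
apply: eq_from_tnth => k; apply/val_inj/eqP; rewrite eqn_leq lower //=.
apply: (upper (n.-1 - tnth w k)%N); rewrite subnKC //.
by rewrite -ltnS (leq_trans (ltn_ord _)) // leqSpred.
Qed.

End Types.

(** * Entropy of a finite distribution and of its image under a map *)

Section FiniteEntropy.
Context {R : realType}.
Implicit Types (x N : R).

(** This is [ln y <= y - 1] at [y = (x * N)^-1], multiplied by [x]; the spare term [- x] is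
    dropped. *)
Lemma oppr_mul_ln_le x N : 0 <= x -> 0 < N ->
  - (x * ln x) <= x * ln N + N^-1.
Proof.
rewrite le_eqVlt => /predU1P[<-|x0] N0.
  by rewrite !mul0r oppr0 add0r invr_ge0 ltW.
have xN0 : 0 < x * N by exact: mulr_gt0.
have : ln (x * N)^-1 <= (x * N)^-1 - 1.
  by rewrite -[X in ln X](subrKC 1) le_ln1Dx // ltrBrDl subrr invr_gt0.
rewrite lnV ?posrE // lnM ?posrE // => /(ler_wpM2l (ltW x0)).
rewrite mulrBr mulr1 invfM mulrA divff ?gt_eqF // mul1r.
by move: (ln x) (ln N) (N^-1) => a b c; lra.
Qed.

Context {W U : finType} (phi : W -> U) (q : W -> R).

Definition fibre_mass u := \sum_(w | phi w == u) q w.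

Lemma sum_fibre_mass (F : U -> R) :
  \sum_u fibre_mass u * F u = \sum_w q w * F (phi w).
Proof.
rewrite [RHS](partition_big phi xpredT) //=; apply: eq_bigr => u _.
by rewrite mulr_suml; apply: eq_bigr => w /eqP ->.
Qed.

Hypotheses (q_ge0 : forall w, 0 <= q w) (q_sum : \sum_w q w = 1).

Lemma mass_le_fibre_mass w : q w <= fibre_mass (phi w).
Proof. by rewrite /fibre_mass (bigD1 w) //= lerDl sumr_ge0. Qed.

Lemma fibre_mass_le1 u : fibre_mass u <= 1.
Proof.
by rewrite -q_sum [leRHS](bigID (fun w => phi w == u)) /= lerDl sumr_ge0.
Qed.

(** With both entropies written as sums over [W], monotonicity of [ln] compares them term by
    term. *)
Lemma entropy_fibre_le :
  - \sum_u fibre_mass u * ln (fibre_mass u) <= - \sum_w q w * ln (q w).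
Proof.
rewrite lerN2 sum_fibre_mass; apply: ler_sum => w _.
have := q_ge0 w; rewrite le_eqVlt => /predU1P[<-|q0]; first by rewrite !mul0r.
by rewrite ler_pM2l // ler_ln ?posrE ?mass_le_fibre_mass //
  (lt_le_trans q0) ?mass_le_fibre_mass.
Qed.

(** A good point is alone in its fibre, so its two terms agree. A bad one is bounded by
    [oppr_mul_ln_le], its term on the right being nonnegative because fibre masses are at most 1. *)
Lemma entropy_fibre_ge (bad : pred W) N : 0 < N ->
    (forall w w', ~~ bad w -> phi w = phi w' -> w = w') ->
  - \sum_w q w * ln (q w) <= - \sum_u fibre_mass u * ln (fibre_mass u)
    + (\sum_(w | bad w) q w) * ln N + #|W|%:R / N.
Proof.
move=> N0 good; rewrite sum_fibre_mass -!sumrN.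
have -> : #|W|%:R / N = \sum_(w : W) N^-1.
  by rewrite sumr_const mulrC mulr_natr.
rewrite mulr_suml [X in _ + X + _]big_mkcond -!big_split /=.
apply: ler_sum => w _; case: ifPn => [_|/good gw]; last first.
  suff -> : fibre_mass (phi w) = q w by rewrite addr0 lerDl invr_ge0 ltW.
  rewrite /fibre_mass (big_pred1 w) // => w' /=.
  by apply/eqP/eqP => [/esym/gw //|->].
rewrite -addrA (le_trans (oppr_mul_ln_le _ N0)) // lerDr oppr_ge0.
by rewrite mulr_ge0_le0 // ln_le0 // fibre_mass_le1.
Qed.

End FiniteEntropy.

Local Open Scope classical_set_scope.

(** * Laws of the blocks of a stationary process, and avoidance of a state *)

Lemma probability_finType (R : realType) (d : measure_display)
    (T : measurableType d) (Pr : probability T R) (W : finType) (X : T -> W)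
    (Q : pred W) (mX : forall w, measurable [set t | X t = w]) :
  measurable [set t | Q (X t)] /\
  Pr [set t | Q (X t)] = (\sum_(w | Q w) Pr [set t | X t = w])%E.
Proof.
have -> : [set t | Q (X t)] = \bigcup_(w in [set` Q]) [set t | X t = w].
  by apply/seteqP; split=> [t Qt|t [w Qw /= ->]//]; exists (X t).
have finQ : finite_set [set` Q] by exact: finite_finset.
split; first exact: fin_bigcup_measurable.
rewrite measure_fin_bigcup //; last by move=> w w' _ _ [t [/= <- <-]].
apply/esym/bigfs => [|w _]; first exact: index_enum_uniq.
by rewrite mem_index_enum.
Qed.

Section Blocks.
Context {T : Type} {n : nat} (S : nat -> T -> 'I_n).

Definition block (k L : nat) (t : T) : L.-tuple 'I_n :=
  [tuple S (k + i)%N t | i < L].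

Lemma word_eventE k L (w : L.-tuple 'I_n) :
  word_event S k w = [set t | block k L t = w].
Proof.
apply/seteqP; split=> t /= H; last by move=> i; rewrite -H tnth_mktuple.
by apply: eq_from_tnth => i; rewrite tnth_mktuple H.
Qed.

End Blocks.

Section Stationary.
Context {R : realType} {d : measure_display} {T : measurableType d}.
Context {Pr : probability T R} {n : nat} {S : nat -> T -> 'I_n}.
Hypotheses (S_process : is_process S) (S_stationary : is_stationary Pr S).

Local Notation q := (word_prob Pr S).

Lemma measurable_block_eq k L (w : L.-tuple 'I_n) :
  measurable [set t | block S k L t = w].
Proof.
rewrite -word_eventE.
have -> : word_event S k w = \bigcap_(i in [set: 'I_L])
    (S (k + i)%N @^-1` [set tnth w i]).
  by apply/seteqP; split=> t H i; [move=> _; exact: H|exact: (H i I)].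
by apply: fin_bigcap_measurable => // i _; exact: S_process.
Qed.

Lemma measurable_block k L (Q : pred (L.-tuple 'I_n)) :
  measurable [set t | Q (block S k L t)].
Proof.
by have [] := probability_finType Pr Q (@measurable_block_eq k L).
Qed.

Lemma prob_block k L (Q : pred (L.-tuple 'I_n)) :
  Pr [set t | Q (block S k L t)] = (\sum_(w | Q w) q w)%:E.
Proof.
have [_ ->] := probability_finType Pr Q (@measurable_block_eq k L).
rewrite -sumEFin; apply: eq_bigr => w _.
by rewrite -word_eventE S_stationary /word_prob fineK // fin_num_measure
  // word_eventE; exact: measurable_block_eq.
Qed.

Lemma word_prob_ge0 L (w : L.-tuple 'I_n) : 0 <= q w.
Proof. exact/fine_ge0. Qed.

Lemma sum_word_prob L : \sum_(w : L.-tuple 'I_n) q w = 1.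
Proof.
have := prob_block 0 (L := L) xpredT => /=.
by rewrite (_ : [set _ | _] = setT) ?probability_setT => [[]|]//; apply/seteqP.
Qed.

Definition state_prob (i : 'I_n) : R := q [tuple i].

Lemma prob_state k i : Pr [set t | S k t = i] = (state_prob i)%:E.
Proof.
have := prob_block k (L := 1) (pred1 [tuple i]); rewrite big_pred1_eq => <-.
congr (Pr _); apply/seteqP; split=> t /=.
  move=> <-; apply/eqP/eq_from_tnth => j; rewrite tnth_mktuple ord1 addn0.
  by rewrite tnth0.
by move=> /eqP/(congr1 (fun w => tnth w ord0)); rewrite tnth_mktuple addn0 tnth0.
Qed.

(** Both sides are the expectation of [g] at the last letter, whose law does not depend on time. *)
Lemma sum_word_prob_last L (g : 'I_n -> R) :
  \sum_(w : L.+1.-tuple 'I_n) q w * g (tnth w ord_max) =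
  \sum_i state_prob i * g i.
Proof.
rewrite (partition_big (fun w : L.+1.-tuple 'I_n => tnth w ord_max) xpredT) //=.
apply: eq_bigr => i _.
under eq_bigr => w /eqP -> do [].
rewrite -mulr_suml; congr (_ * _); apply: EFin_inj.
rewrite -(prob_block 0) -(prob_state L); congr (Pr _).
apply/seteqP; split => t /=; rewrite tnth_mktuple /= add0n; first by move/eqP.
by move=> ->.
Qed.

Definition avoid_prob (j : 'I_n) (m : nat) : R :=
  \sum_(w : m.-tuple 'I_n | j \notin w) q w.

Lemma notin_block j k L t :
  j \notin block S k L t <-> forall x, (x < L)%N -> S (k + x)%N t <> j.
Proof.
split=> [jS x xL E|H]; last first.
  by apply/negP => /tnthP[x]; rewrite tnth_mktuple => /esym; exact: H.
by move/negP: jS; apply; apply/tnthP; exists (Ordinal xL); rewrite tnth_mktuple.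
Qed.

Lemma prob_notin_block j k m :
  Pr [set t | forall x, (x < m)%N -> S (k + x)%N t <> j] = (avoid_prob j m)%:E.
Proof.
rewrite -(prob_block k); congr (Pr _).
by apply/seteqP; split=> t /=; rewrite notin_block.
Qed.

Lemma sum_word_prob_avoid_window j k m L : (k + m <= L)%N ->
  \sum_(w : L.-tuple 'I_n |
    [forall x : 'I_L, (k <= x < k + m)%N ==> (tnth w x != j)]) q w =
  avoid_prob j m.
Proof.
move=> kmL; apply: EFin_inj; rewrite -(prob_block 0) -(prob_notin_block j k).
congr (Pr _); apply/seteqP; split=> t /=.
  move=> /forallP H x xm.
  have xL : (k + x < L)%N by rewrite (leq_trans _ kmL) // ltn_add2l.
  have := H (Ordinal xL); rewrite tnth_mktuple /= leq_addr ltn_add2l xm /=.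
  by rewrite add0n => /eqP.
move=> H; apply/forallP => x; apply/implyP => /andP[kx xkm].
rewrite tnth_mktuple add0n; apply/eqP.
by have := H (x - k)%N; rewrite ltn_subLR // subnKC //; exact.
Qed.

(** A union bound over the missing state and the part of the word that misses it. *)
Lemma sum_word_prob_not_visits h L : (h <= L)%N ->
  \sum_(w : L.-tuple 'I_n | ~~ visits_both_parts h w) q w <=
  \sum_j (avoid_prob j h + avoid_prob j (L - h)).
Proof.
move=> hL.
have H1 j := @sum_word_prob_avoid_window j 0 h L hL.
have H2 j := @sum_word_prob_avoid_window j h (L - h) L.
under [leRHS]eq_bigr => j _ do rewrite -H1 -H2 ?subnKC // [X in X + _]big_mkcond
  [X in _ + X]big_mkcond -big_split /=.
rewrite exchange_big /= big_mkcond; apply: ler_sum => w _.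
have pos (b : bool) : 0 <= if b then q w else 0.
  by case: b; rewrite ?word_prob_ge0.
case: ifPn => [|_]; last by apply: sumr_ge0 => j _; exact: addr_ge0.
rewrite negb_forall => /existsP[a]; rewrite negb_and => Ha.
rewrite (bigD1 a) //= -[leLHS]addr0 lerD //; last first.
  by apply: sumr_ge0 => j _; exact: addr_ge0.
case/orP: Ha; rewrite negb_exists => /forallP Ha.
  rewrite ifT ?lerDl //; apply/forallP => x; apply/implyP => /= xh.
  by have := Ha x; rewrite negb_and xh.
rewrite [X in _ + X]ifT ?lerDr //; apply/forallP => x.
by apply/implyP => /andP[hx _]; have := Ha x; rewrite negb_and hx.
Qed.

(** The limit is the probability of never visiting [j]. That event lies in the shift-invariant event
    of visiting [j] only finitely often, to which ergodicity applies. *)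
Lemma avoid_prob_cvg0 j : is_ergodic Pr S -> 0 < state_prob j ->
  avoid_prob j m @[m --> \oo] --> 0.
Proof.
move=> S_ergodic pj.
pose F N := [set t | forall k, (N <= k)%N -> S k t <> j].
have mne k : measurable [set t | S k t <> j].
  by rewrite (_ : mkset _ = ~` (S k @^-1` [set j])) //; exact: measurableC.
have mF N : measurable (F N).
  rewrite (_ : F N = \bigcap_(k in [set k | (N <= k)%N]) [set t | S k t <> j]).
    exact: bigcap_measurableType.
  by apply/seteqP; split=> t H k; exact: H.
have F0 : Pr (F 0) = 0%E.
  pose B := [set x : nat -> 'I_n | exists N, forall k, (N <= k)%N -> x k <> j].
  have FB : [set t | B (fun k => S k t)] = \bigcup_N F N.
    by apply/seteqP; split => t [N] => [H|_ H]; exists N.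
  have mB : <<s @cylinders n >> B.
    have -> : B =
        \bigcup_N ~` \bigcup_k [set x : nat -> 'I_n | x (N + k)%N = j].
      apply/seteqP; split=> x [N] => [H|_ H]; exists N => //.
        by move=> [k _ /= xj]; apply: (H (N + k)%N); rewrite ?leq_addr.
      move=> k Nk xj; apply: H.
      by exists (k - N)%N; rewrite //= subnKC.
    apply: sigma_algebra_bigcup => N; rewrite -setTD; apply: sigma_algebraCD.
    apply: sigma_algebra_bigcup => k; apply: sub_sigma_algebra.
    by exists (N + k)%N, j.
  have iB : @Defs.shift n @^-1` B = B.
    apply/seteqP; split=> x [N H].
      by exists N.+1 => -[//|k] Nk; exact: H.
    by exists N => k Nk; apply: H; exact: leqW.
  have cF : Pr \o F @ \oo --> Pr (\bigcup_N F N).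
    apply: nondecreasing_cvg_mu => //; first exact: bigcup_measurable.
    move=> N N' NN'; apply/subsetPset => t H k Nk; apply: H.
    exact: leq_trans Nk.
  (* Avoiding [j] from time [N] on entails avoiding it at time [N]; this uniform bound excludes
     probability 1 for the union. *)
  have PF N : (Pr (F N) <= (1 - state_prob j)%:E)%E.
    apply: (@le_trans _ _ (Pr (~` [set t | S N t = j]))).
      by apply: le_measure; rewrite ?inE //; [exact: mne|move=> t; exact].
    rewrite probability_setC; last exact: S_process.
    by rewrite prob_state.
  have PB : (Pr (\bigcup_N F N) <= (1 - state_prob j)%:E)%E.
    rewrite -(cvg_lim _ cF) //; apply: lime_le; first exact: cvgP cF.
    by near=> N; exact: PF.
  have Pr0 : Pr (\bigcup_N F N) = 0%E.
    rewrite -FB; case: (S_ergodic B mB iB) => //; rewrite FB => P1.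
    by move: PB; rewrite P1 lee_fin lerBrDr gerDl leNgt pj.
  apply/eqP; rewrite eq_le measure_ge0 andbT -Pr0.
  apply: le_measure; rewrite ?inE //; first exact: bigcup_measurable.
  exact: bigcup_sup.
pose E m := [set t | forall x, (x < m)%N -> S (0 + x)%N t <> j].
have mE m : measurable (E m).
  rewrite (_ : E m = [set t | j \notin block S 0 m t]).
    exact: (@measurable_block 0 m (fun w => j \notin w)).
  by apply/seteqP; split => t /= /notin_block.
have EF : \bigcap_m E m = F 0.
  apply/seteqP; split=> t H.
    by move=> k _; apply: (H k.+1 I k).
  by move=> m _ x _; exact: H.
have : Pr \o E @ \oo --> Pr (\bigcap_m E m).
  apply: nonincreasing_cvg_mu => //.
  - by rewrite (le_lt_trans (probability_le1 _ _)) ?ltry.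
  - by rewrite EF.
  - move=> m m' mm'; apply/subsetPset => t H x xm.
    by apply: H; exact: leq_trans mm'.
rewrite EF F0 => /fine_cvg; rewrite /= => cv.
under eq_fun => m do
  rewrite -[avoid_prob j m]/(fine _%:E) -(prob_notin_block j 0).
exact: cv.
Unshelve. all: by end_near. Qed.

End Stationary.

(** * Words extended by one letter, and the chain kept away from one state *)

Lemma big_tuple_rcons (R : nmodType) (A : finType) L (F : L.+1.-tuple A -> R) :
  \sum_(w : L.+1.-tuple A) F w =
  \sum_(w : L.-tuple A) \sum_a F [tuple of rcons w a].
Proof.
rewrite pair_big /=.
rewrite (reindex (fun p : L.-tuple A * A => [tuple of rcons p.1 p.2])) //=.
apply/onW_bij/inj_card_bij => [[w a] [w' a'] /(congr1 val)/rcons_inj[]|].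
  by move=> /val_inj -> ->.
by rewrite card_prod !card_tuple expnSr.
Qed.

Lemma tnth_rcons_last (A : Type) L (w : L.-tuple A) a :
  tnth [tuple of rcons w a] ord_max = a.
Proof. by rewrite (tnth_nth a) /= nth_rcons size_tuple ltnn eqxx. Qed.

Section Avoidance.
Context {R : realType} {n : nat} {P : 'M[R]_n} (p : 'I_n -> R).
Hypotheses (P_stoch : is_stochastic P) (p_gt0 : forall i, 0 < p i).
Hypothesis p_inv : forall g,
  \sum_i p i * (\sum_b P i b * g b) = \sum_i p i * g i.

(* [avoid_step j] is the restriction of [P] to the complement of [j], so
   [avoid_from j m i] is the probability that the chain started at [i] stays
   away from [j] during the [m] following steps. *)
Definition avoid_step (j : 'I_n) (g : 'I_n -> R) (i : 'I_n) : R :=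
  \sum_(b | b != j) P i b * g b.

Definition avoid_from j m : 'I_n -> R := iter m (avoid_step j) (fun=> 1).

Lemma avoid_from_ge0 j m i : 0 <= avoid_from j m i.
Proof.
elim: m i => //= m IH i; apply: sumr_ge0 => b _; rewrite mulr_ge0 //.
by case: P_stoch.
Qed.

Lemma avoid_from_le1 j m i : avoid_from j m i <= 1.
Proof.
have [P0 P1] := P_stoch.
elim: m i => //= m IH i; rewrite /avoid_step -(P1 i).
rewrite [leRHS](bigID (fun b => b != j)) /= -[leLHS]addr0 lerD ?sumr_ge0 //.
by apply: ler_sum => b _; rewrite ler_piMr.
Qed.

(** [avoid_step] is linear and monotone, so each run of [m] steps contributes a factor [c], and the
    [l] remaining steps at most a factor 1. *)
Lemma avoid_from_scale j m c : 0 <= c -> (forall i, avoid_from j m i <= c) ->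
  forall k l i, avoid_from j (l + k * m) i <= c ^+ k.
Proof.
move=> c0 H; have [P0 P1] := P_stoch.
have step l i : avoid_from j (l + m) i <= c * avoid_from j l i.
  elim: l i => [|l IH] i; first by rewrite mulr1.
  rewrite /= /avoid_step mulr_sumr; apply: ler_sum => b _.
  by rewrite mulrCA ler_wpM2l.
elim=> [|k IH] l i; first by rewrite addn0 expr0 avoid_from_le1.
by rewrite mulSn addnCA addnC (le_trans (step _ _)) // exprS ler_wpM2l.
Qed.

(** One term of a nonnegative sum is at most the sum, which invariance of [p] evaluates. Since
    [p i > 0], a bound for the stationary start becomes one for each starting state. *)
Lemma mul_avoid_from_le j m i :
  p i * avoid_from j m.+1 i <= \sum_(b | b != j) p b * avoid_from j m b.
Proof.
apply: (@le_trans _ _ (\sum_i p i * avoid_from j m.+1 i)).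
  rewrite (bigD1 i) //= lerDl sumr_ge0 // => b _.
  by apply: mulr_ge0; [exact: ltW|exact: (avoid_from_ge0 j m.+1)].
under eq_bigr => b _ do rewrite /= /avoid_step big_mkcond /=.
rewrite [leRHS]big_mkcond /=.
have := p_inv (fun b => if b != j then avoid_from j m b else 0).
move=> E; rewrite le_eqVlt; apply/orP; left; apply/eqP.
transitivity (\sum_i p i *
    \sum_b P i b * (if b != j then avoid_from j m b else 0)).
  apply: eq_bigr => b _; congr (_ * _); apply: eq_bigr => a _.
  by case: ifP; rewrite ?mulr0.
by rewrite E; apply: eq_bigr => b _; case: ifP; rewrite ?mulr0.
Qed.

End Avoidance.

(** * Avoidance and block entropies of a stationary Markov process *)

Section Markov.
Context {R : realType} {d : measure_display} {T : measurableType d}.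
Context {Pr : probability T R} {n : nat} {S : nat -> T -> 'I_n}.
Context {P : 'M[R]_n}.
Hypotheses (S_process : is_process S) (S_stationary : is_stationary Pr S).
Hypothesis S_markov : is_markov Pr S P.

Local Notation q := (word_prob Pr S).
Local Notation p := (state_prob (Pr := Pr) (S := S)).

Lemma state_prob_invariant (g : 'I_n -> R) :
  \sum_i p i * (\sum_b P i b * g b) = \sum_i p i * g i.
Proof.
rewrite -(sum_word_prob_last S_process S_stationary 0).
rewrite -(sum_word_prob_last S_process S_stationary 1) [RHS]big_tuple_rcons.
apply: eq_bigr => w _; rewrite mulr_sumr; apply: eq_bigr => b _.
by rewrite tnth_rcons_last (proj2 S_markov) mulrA.
Qed.

Lemma avoid_probS j m :
  avoid_prob (Pr := Pr) (S := S) j m.+1 =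
  \sum_(b | b != j) p b * avoid_from (P := P) j m b.
Proof.
have -> : avoid_prob (Pr := Pr) (S := S) j m.+1 =
    \sum_(w : m.+1.-tuple 'I_n | j \notin w) q w * 1.
  by apply: eq_bigr => w _; rewrite mulr1.
rewrite /avoid_from.
set g := (fun=> 1).
transitivity
  (\sum_(w : m.+1.-tuple 'I_n | j \notin w) q w * g (tnth w ord_max)).
  by [].
(* The induction needs an arbitrary weight on the last letter: summing out that letter replaces [g]
   by [avoid_step j g]. *)
move: g; elim: m => [|m IH] g.
  rewrite big_mkcond [RHS]big_mkcond /=.
  pose g' b := if b != j then g b else 0.
  transitivity (\sum_(w : 1.-tuple 'I_n) q w * g' (tnth w ord_max)).
    apply: eq_bigr => w _; case/tupleP: w => b w; rewrite (tuple0 w) /g'.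
    rewrite (_ : (j \notin _) = (b != j)); last first.
      by congr (~~ _); rewrite (eq_sym b); exact: mem_seq1.
    by rewrite (tnth_nth b) /=; case: ifP; rewrite ?mulr0.
  rewrite (sum_word_prob_last S_process S_stationary 0); apply: eq_bigr => b _.
  by rewrite /g'; case: ifP; rewrite ?mulr0.
rewrite iterSr -IH [LHS]big_mkcond [LHS]big_tuple_rcons [RHS]big_mkcond /=.
apply: eq_bigr => w _; case: ifPn => [jw|jw]; last first.
  rewrite big1 // => b _.
  by rewrite mem_rcons in_cons negb_or (negbTE jw) andbF.
rewrite /avoid_step mulr_sumr [RHS]big_mkcond /=; apply: eq_bigr => b _.
rewrite mem_rcons in_cons negb_or jw andbT eq_sym.
by case: ifP; rewrite ?mulr0 // tnth_rcons_last (proj2 S_markov) mulrA.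
Qed.

(** The conditional entropy of the next state given the present one, in natural units. *)
Definition markov_entropy : R :=
  - \sum_i p i * (\sum_b P i b * ln (P i b)).

(** The chain rule: by the Markov property the logarithm of an extended word splits, and the new
    part depends only on the last letter. *)
Lemma word_entropyS L :
  - (\sum_(w : L.+2.-tuple 'I_n) q w * ln (q w)) =
  - (\sum_(w : L.+1.-tuple 'I_n) q w * ln (q w)) + markov_entropy.
Proof.
rewrite [in LHS]big_tuple_rcons /markov_entropy -opprD; congr (- _).
rewrite -(sum_word_prob_last S_process S_stationary L) -big_split /=.
have [[P0 P1] qM] := S_markov.
apply: eq_bigr => w _; rewrite -mulrDr -[ln (q w)]mul1r.
rewrite -(P1 (tnth w ord_max)) mulr_suml -big_split mulr_sumr /=.
apply: eq_bigr => b _; rewrite qM -mulrA -mulrDr.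
(* Null words and null transitions are set apart, as [lnM] needs positive factors. *)
have [->|qw0] := eqVneq (q w) 0; first by rewrite !mul0r.
have [->|Pb0] := eqVneq (P (tnth w ord_max) b) 0;
  first by rewrite !(mul0r, mulr0).
by rewrite lnM ?posrE ?lt_def ?qw0 ?Pb0 ?word_prob_ge0 /=.
Qed.

Lemma word_entropyE L :
  - (\sum_(w : L.+1.-tuple 'I_n) q w * ln (q w)) =
  - (\sum_(w : 1.-tuple 'I_n) q w * ln (q w)) + markov_entropy * L%:R.
Proof.
elim: L => [|L IH]; first by rewrite mulr0 addr0.
by rewrite word_entropyS IH -addrA -natr1 mulrDr mulr1.
Qed.

End Markov.

(** * Decay of the avoidance probabilities and of the entropy gap *)

Section Decay.
Context {R : realType} {d : measure_display} {T : measurableType d}.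
Context {Pr : probability T R} {n : nat} {S : nat -> T -> 'I_n}.
Context {P : 'M[R]_n}.
Hypotheses (S_process : is_process S) (S_states : has_all_states Pr S).
Hypotheses (S_stationary : is_stationary Pr S) (S_markov : is_markov Pr S P).
Hypothesis S_ergodic : is_ergodic Pr S.

Local Notation q := (word_prob Pr S).
Local Notation p := (state_prob (Pr := Pr) (S := S)).
Local Notation a := (avoid_prob (Pr := Pr) (S := S)).

Lemma state_prob_gt0 i : 0 < p i.
Proof.
have := S_states i.
by rewrite [X in Pr X](_ : _ = [set t | S 0%N t = i]) // prob_state.
Qed.

Lemma sum_state_prob : \sum_i p i = 1.
Proof.
rewrite -(sum_word_prob S_process S_stationary 1).
under [RHS]eq_bigr => w _ do rewrite -[q w]mulr1.
rewrite (sum_word_prob_last S_process S_stationary 0 (fun=> 1)).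
by apply: eq_bigr => i _; rewrite mulr1.
Qed.

Lemma avoid_prob_ge0 j m : 0 <= a j m.
Proof. by apply: sumr_ge0 => w _; exact: word_prob_ge0. Qed.

(* Ergodicity makes the probability of missing [j] during [M] steps smaller
   than 1/4, uniformly in the starting state; iterating gives exponential
   decay, of which only the inverse square rate is retained. *)
Lemma avoid_prob_le_inv_sqr j :
  exists C : R, forall m, a j m * m%:R ^+ 2 <= C.
Proof.
have [M M0 HM] : exists2 M, (0 < M)%N & forall i, a j M < p i / 4.
  have cv := avoid_prob_cvg0 S_process S_stationary S_ergodic
    (state_prob_gt0 j).
  have H : \forall m \near \oo, forall i, a j m < p i / 4.
    apply: filter_forall => i; apply: (cvgr_lt 0 cv).
    by rewrite divr_gt0 // state_prob_gt0.
  near \oo => m; exists m; first by near: m; exact: nbhs_infty_gt.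
  by near: m.
case: M M0 HM => // M _ HM.
have [P_stoch _] := S_markov.
have f4 i : avoid_from (P := P) j M.+1 i <= 4^-1.
  rewrite -(ler_pM2l (state_prob_gt0 i)).
  apply: le_trans (ltW (HM i)).
  rewrite (avoid_probS S_process S_stationary S_markov).
  apply: mul_avoid_from_le => //; first exact: state_prob_gt0.
  exact: state_prob_invariant.
exists (4 * M.+1%:R ^+ 2) => -[|m].
  by rewrite expr0n mulr0 mulr_ge0 // exprn_ge0.
pose k := (m %/ M.+1)%N.
have am : a j m.+1 <= 4^-1 ^+ k.
  rewrite (avoid_probS S_process S_stationary S_markov).
  apply: (@le_trans _ _ (\sum_b p b * 4^-1 ^+ k)).
    rewrite big_mkcond; apply: ler_sum => b _; case: ifP => _; last first.
      by rewrite mulr_ge0 ?exprn_ge0 // ltW // state_prob_gt0.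
    rewrite ler_wpM2l //; first by rewrite ltW // state_prob_gt0.
    by rewrite (divn_eq m M.+1) addnC; exact: avoid_from_scale.
  by rewrite -mulr_suml sum_state_prob mul1r.
(* From [m < M.+1 * k.+1] and [k < 2 ^ k]. The ratio 1/4 was chosen so that its [k]-th power cancels
   the square of [2 ^+ k]. *)
have m2 : m.+1%:R <= 2 * M.+1%:R * 2 ^+ k :> R.
  rewrite -natrX -!natrM ler_nat (@leq_trans (M.+1 * k.+1)%N) //.
    by rewrite mulnC ltn_ceil.
  by rewrite mulnAC [leqRHS]mulnC leq_pmul2l //
    (leq_trans (ltn_expl k (ltnSn 1))) // leq_pmull.
apply: (@le_trans _ _ (4^-1 ^+ k * (2 * M.+1%:R * 2 ^+ k) ^+ 2)).
  apply: ler_pM => //; first exact: avoid_prob_ge0.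
  by rewrite ler_pXn2r // ?nnegrE // mulr_ge0 // exprn_ge0.
rewrite !exprMn -exprM [(k * 2)%N]mulnC exprM.
rewrite (_ : 2 ^+ 2 = 4 :> R); last by ring.
by rewrite mulrC -!mulrA -exprMn divff // expr1n mulr1.
Unshelve. all: by end_near. Qed.

Lemma not_visits_le_inv_sqr : exists2 C : R, 0 <= C & forall L, (2 <= L)%N ->
  (\sum_(w : L.-tuple 'I_n | ~~ visits_both_parts L./2 w) q w) * L%:R ^+ 2
    <= C.
Proof.
have [C HC] := choice avoid_prob_le_inv_sqr.
have C0 j : 0 <= C j by rewrite (le_trans _ (HC j 0)) // expr0n mulr0.
exists (\sum_j (9 * C j + 9 * C j)).
  by apply: sumr_ge0 => j _; rewrite addr_ge0 // mulr_ge0.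
move=> L L2; have a0 := avoid_prob_ge0.
have hL : (L./2 <= L)%N by rewrite leq_half_double; lia.
(* For [L >= 2] both parts have length at least [L / 3], the worst case being [L = 3]; squaring
   gives the 9. *)
have L3 h : (L <= 3 * h)%N -> forall j, a j h * L%:R ^+ 2 <= 9 * C j.
  move=> Lh j; apply: (@le_trans _ _ (a j h * (3 * h%:R) ^+ 2)).
    rewrite ler_wpM2l // ler_pXn2r // ?nnegrE ?mulr_ge0 //.
    by rewrite -natrM ler_nat.
  by rewrite exprMn mulrCA (_ : 3 ^+ 2 = 9 :> R) ?ler_wpM2l //; ring.
have nV := sum_word_prob_not_visits S_process S_stationary hL.
apply: le_trans (ler_wpM2r _ nV) _.
  by rewrite exprn_ge0.
rewrite mulr_suml; apply: ler_sum => j _; rewrite mulrDl lerD // L3 //.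
  by have := odd_double_half L; lia.
by have := odd_double_half L; lia.
Qed.

Lemma block_entropyE L : block_entropy Pr S L =
  - (\sum_(w : L.-tuple 'I_n) q w * ln (q w)) / ln 2.
Proof.
by rewrite /block_entropy mulNr mulr_suml; under eq_bigr do rewrite /log2 mulrA.
Qed.

Lemma perm_block_entropyE L : perm_block_entropy Pr S L =
  - (let m := fibre_mass (@word_type n L) (word_prob Pr S (L := L)) in
     \sum_s m s * ln (m s)) / ln 2.
Proof.
rewrite /perm_block_entropy mulNr mulr_suml; congr (- _).
apply: eq_bigr => s _.
have -> : perm_prob Pr S s =
    fibre_mass (@word_type n L) (word_prob Pr S (L := L)) s.
  by apply: eq_bigl => w; rewrite of_type_word_type eq_sym.
by rewrite /log2 mulrA.
Qed.

Lemma perm_block_entropy_le L :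
  perm_block_entropy Pr S L <= block_entropy Pr S L.
Proof.
rewrite block_entropyE perm_block_entropyE ler_wpM2r //.
  by rewrite invr_ge0 ln_ge0 // ler1n.
by apply: entropy_fibre_le => //; exact: word_prob_ge0.
Qed.

(** The bad words have mass of order [1 / L ^ 2], and [ln N] is linear in [L]: their product is of
    order [1 / L]. *)
Lemma block_entropy_sub_perm_le : exists C : R, forall L, (2 <= L)%N ->
  block_entropy Pr S L - perm_block_entropy Pr S L <= C / L%:R.
Proof.
have [C C0 HC] := not_visits_le_inv_sqr.
have ln20 : 0 < ln 2 :> R by rewrite ln_gt0 // ltr1n.
exists ((C * ln (2 * n.+1%:R) + 1) / ln 2) => L L2.
have L0 : 0 < L%:R :> R by rewrite ltr0n; lia.
pose N : R := (2 * n.+1%:R) ^+ L.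
have N0 : 0 < N by rewrite exprn_gt0 // mulr_gt0.
rewrite block_entropyE perm_block_entropyE -mulrBl.
rewrite mulrAC ler_wpM2r ?invr_ge0 ?(ltW ln20) //.
have q0 (w : L.-tuple 'I_n) : 0 <= q w by exact: word_prob_ge0.
have good (w w' : L.-tuple 'I_n) : ~~ ~~ visits_both_parts L./2 w ->
    word_type w = word_type w' -> w = w'.
  by rewrite negbK; exact: word_type_inj_visits.
have := entropy_fibre_ge q0 (sum_word_prob S_process S_stationary L) N0 good.
rewrite -addrA addrC -lerBlDr => /le_trans; apply.
rewrite mulrDl mul1r lerD //.
  rewrite lnXn ?mulr_gt0 // -[ln _ *+ L]mulr_natr.
  have l0 : 0 <= ln (2 * n.+1%:R) :> R by rewrite ln_ge0 // -natrM ler1n.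
  move: (HC L L2) l0; move: (\sum_(w | _) _) (ln (2 * n.+1%:R)) => X l HX l0.
  rewrite ler_pdivlMr // (_ : X * _ * _ = X * L%:R ^+ 2 * l); last by ring.
  exact: ler_wpM2r.
(* It remains to see that [n ^ L * L <= (2 * n.+1) ^ L], which follows from [L < 2 ^ L]. *)
rewrite card_tuple card_ord ler_pdivrMr // mulrC ler_pdivlMr //.
rewrite /N -!natrM -natrX ler_nat expnMn mulnC leq_mul //.
  by rewrite ltnW // ltn_expl.
by rewrite leq_exp2r //; lia.
Qed.

Lemma block_entropy_sub_perm_cvg0 :
  block_entropy Pr S L - perm_block_entropy Pr S L @[L --> \oo] --> 0.
Proof.
have [C HC] := block_entropy_sub_perm_le.
have cvC : (C / L%:R) @[L --> \oo] --> 0.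
  rewrite -(mulr0 C); apply: cvgM; first exact: cvg_cst.
  by rewrite -cvg_shiftS; exact: cvg_harmonic.
apply: (@squeeze_cvgr _ _ _ _ (fun=> 0) (fun L : nat => C / L%:R)) => //.
- near=> L; rewrite subr_ge0 perm_block_entropy_le /= HC //.
  by near: L; exact: nbhs_infty_ge.
- exact: cvg_cst.
Unshelve. all: by end_near. Qed.

End Decay.

(** * Convergence of the rates and of the excess entropies *)

Theorem theorem14 (R : realType) (d : measure_display) (T : measurableType d)
    (Pr : probability T R) (n : nat) (hn : (1 <= n)%N)
    (S : nat -> T -> 'I_n) (P : 'M[R]_n)
    (S_process : is_process S)
    (S_states : has_all_states Pr S)
    (S_stationary : is_stationary Pr S)
    (S_markov : is_markov Pr S P)
    (S_ergodic : is_ergodic Pr S) :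
  excess_entropy_exists Pr S /\
  perm_excess_entropy_exists Pr S /\
  perm_excess_entropy Pr S = excess_entropy Pr S.
Proof.
pose h : R := markov_entropy (Pr := Pr) (S := S) (P := P) / ln 2.
(* The intercept of the affine function that [block_entropy] agrees with from length 1 on; the
   limits below therefore skip [L = 0]. *)
pose e : R := block_entropy Pr S 1 - h.
have HE L : block_entropy Pr S L.+1 = e + h * L.+1%:R.
  rewrite block_entropyE (word_entropyE S_process S_stationary S_markov).
  rewrite mulrDl -block_entropyE mulrAC -/h -natr1 mulrDr mulr1 /e.
  by rewrite addrACA addNr addr0.
have cvd := block_entropy_sub_perm_cvg0 S_process S_states S_stationary
  S_markov S_ergodic.
have cvH : block_entropy Pr S L - h * L%:R @[L --> \oo] --> e.
  rewrite -cvg_shiftS; under eq_fun => L do rewrite HE addrK.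
  exact: cvg_cst.
have cvK : perm_block_entropy Pr S L - h * L%:R @[L --> \oo] --> e.
  rewrite -[e]subr0; under eq_fun => L.
    rewrite (_ : _ - _ = (block_entropy Pr S L - h * L%:R) -
      (block_entropy Pr S L - perm_block_entropy Pr S L)); last by ring.
    over.
  exact: cvgB.
(* A convergent excess determines the rate: divided by the length it vanishes. The shift by one
   makes the divisor nonzero. *)
have rate (f : nat -> R) : f L - h * L%:R @[L --> \oo] --> e ->
    f L / L%:R @[L --> \oo] --> h.
  move=> cf; rewrite -cvg_shiftS.
  have -> : [sequence f L.+1 / L.+1%:R]_L =
      fun L => (f L.+1 - h * L.+1%:R) * harmonic L + h.
    by apply/funext => L /=; rewrite mulrBl -mulrA divff ?mulr1 ?subrK.
  suff : (f L.+1 - h * L.+1%:R) * harmonic L + h @[L --> \oo] --> e * 0 + h.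
    by rewrite mulr0 add0r.
  apply: cvgD; last exact: cvg_cst.
  apply: cvgM; last exact: cvg_harmonic.
  by rewrite -cvg_shiftS in cf.
have rH := rate _ cvH; have rK := rate _ cvK.
have hH : entropy_rate Pr S = h by exact: cvg_lim rH.
have hK : perm_entropy_rate Pr S = h by exact: cvg_lim rK.
rewrite /excess_entropy_exists /perm_excess_entropy_exists.
rewrite /perm_excess_entropy /excess_entropy hH hK.
split; first by split; [exact: cvgP rH|exact: cvgP cvH].
split; first by split; [exact: cvgP rK|exact: cvgP cvK].
by rewrite (cvg_lim _ cvH) // (cvg_lim _ cvK).
Qed.
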